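(* Let $k$ be an algebraically closed field of characteristic $p>0$ and let $H$ be a finite-dimensional pointed cocommutative rank one Hopf algebra over $k$ with $H\neq H_0$. Then $H$ is isomorphic to a Hopf algebra $H_F$ for some tuple $F=(G,\chi,c,a,(\alpha_{-1},\alpha_0))$. Furthermore, $x$ is a common eigenvector of the conjugation action of $G$.
   Context: For a finite-dimensional Hopf algebra $H$ over $k$: $G(H)$ is the group of group-like elements; the coradical $H_0$ is the sum of the simple subcoalgebras; $H_1=\Delta^{-1}(H\otimes H_0+H_0\otimes H)$. $H$ is pointed if all simple subcoalgebras are one-dimensional, so that $H_0=kG(H)$. A pointed $H$ has rank $t$ if $\dim_k k\otimes_{H_0}H_1=t+1$ ($k$ trivial via the counit). The Hopf algebra $H_F$ and its generator $x$. Let $F=(G,\chi,c,a,(\alpha_{-1},\alpha_0))$ where $G$ is a finite group, $a\in Z(G)$, $\chi:G\to k^*$ a linear character with $\chi(a)=1$, $c:G\to k$ a map with $c(hg)=\chi(g)c(h)+c(g)$ for all $g,h\in G$ and $c(a)=0$, and $\alpha_{-1},\alpha_0\in k$ with $\alpha_0\in\{0,1\}$ and $\alpha_{-1}=0$ if $\alpha_0=0$. It is assumed that if $\alpha_0=0$ then $c(g)(a^p-1)=0$ in $kG$ for all $g\in G$; and if $\alpha_0=1$ then $a^p=a$, and for all $g\in G$ one has $\chi(g)\in\mathbb{F}_p^*$ and $(\alpha_{-1}(\chi(g)-1)+c(g)^p-c(g))(a-1)=0$ in $kG$. $H_F$ is the algebra containing $kG$ and an element $x$, with basis $\{gx^i: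 g\in G,0\le i\le p-1\}$ and relations $x^p=\alpha_{-1}(a^p-1)+\alpha_0x$, $gxg^{-1}=\chi(g)x+c(g)(a-1)$ ($g\in G$); its Hopf structure is $\Delta(gx^i)=(g\otimes g)(x\otimes a+1\otimes x)^i$, $\epsilon(gx^i)=\delta_{i,0}$, $S(gx^i)=(-xa^{-1})^ig^{-1}$.
   Formalization: H is additionally assumed to be generated as an algebra by H_1; without this the claim fails, e.g. for the dual of k[t]/(t^{p^2}) with t primitive, which is pointed, cocommutative, of rank one and not an H_F. Every H_F is generated by its H_1. *)

(* Defs.v *)
From HB Require Import structures.
From mathcomp Require Import all_boot all_order all_algebra all_fingroup.
From mathcomp Require Import all_solvable all_field.
From mathcomp Require Import boolp classical_sets.

Set Implicit Arguments.
Unset Strict Implicit.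
Unset Printing Implicit Defensive.

Import GRing.Theory.
Local Open Scope ring_scope.

(* The tensor product of two finite-dimensional spaces, realised by           *)
(* coordinates in the bases [vbasis {:U}] and [vbasis {:V}].  Nothing depends *)
(* on these bases: [tlift_pure], [linear_tlift] and [tensor_ind] give the     *)
(* universal property.                                                        *)
Definition tensor (k : fieldType) (U V : vectType k) : Type :=
  'M[k]_(\dim {:U}, \dim {:V}).

HB.instance Definition _ (k : fieldType) (U V : vectType k) :=
  Vector.copy (tensor U V) 'M[k]_(\dim {:U}, \dim {:V}).

Section TensorSpaces.
Variable k : fieldType.

Definition pure (U V : vectType k) (u : U) (v : V) : tensor U V :=
  \matrix_(i, j) (coord (vbasis {:U}) i u * coord (vbasis {:V}) j v).

(* For bilinear [b], the linear map with u (x) v |-> b u v. *)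
Definition tlift (U V W : vectType k) (b : U -> V -> W) (t : tensor U V) : W :=
  \sum_i \sum_j (t i j) *: b (vbasis {:U})`_i (vbasis {:V})`_j.

Definition tmap (U V U' V' : vectType k) (f : U -> U') (g : V -> V') :
    tensor U V -> tensor U' V' :=
  tlift (fun u v => pure (f u) (g v)).

Definition tswap (U V : vectType k) : tensor U V -> tensor V U :=
  tlift (fun u v => pure v u).

Definition tassoc (U V W : vectType k) :
    tensor (tensor U V) W -> tensor U (tensor V W) :=
  tlift (fun t w => tlift (fun u v => pure u (pure v w)) t).

(* A (x) B as a subspace of U (x) V. *)
Definition tensorv (U V : vectType k) (A : {vspace U}) (B : {vspace V}) :
    {vspace tensor U V} :=
  <<[seq pure u v | u <- vbasis A, v <- vbasis B]>>%VS.

End TensorSpaces.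

Notation "u \ox v" := (pure u v)
  (at level 40, left associativity) : ring_scope.

Section TensorTheory.
Variable k : fieldType.
Implicit Types U V W : vectType k.

Fact pure_linearl U V (v : V) : linear (fun u : U => u \ox v).
Proof.
by move=> c u1 u2; apply/matrixP=> i j; rewrite !mxE linearP /= mulrDl mulrA.
Qed.

Fact pure_linearr U V (u : U) : linear (fun v : V => u \ox v).
Proof.
by move=> c v1 v2; apply/matrixP=> i j; rewrite !mxE linearP /= mulrDr mulrCA.
Qed.

HB.instance Definition _ U V (u : U) :=
  GRing.isLinear.Build k V (tensor U V) _ (@pure k U V u) (pure_linearr u).

Fact tlift_linear U V W (b : U -> V -> W) : linear (tlift b).
Proof.
move=> c s t; rewrite /tlift scaler_sumr -big_split /=; apply: eq_bigr => i _.
rewrite scaler_sumr -big_split /=; apply: eq_bigr => j _.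
by rewrite !mxE scalerDl scalerA.
Qed.

HB.instance Definition _ U V W (b : U -> V -> W) :=
  GRing.isLinear.Build k (tensor U V) W _ (tlift b) (tlift_linear b).

Lemma tlift_pure U V W (b : U -> V -> W) u v :
  (forall v, linear (b^~ v)) -> (forall u, linear (b u)) ->
  tlift b (u \ox v) = b u v.
Proof.
move=> bl br.
have bsl w (I : finType) (F : I -> k) (x : I -> U) :
    b (\sum_i F i *: x i) w = \sum_i F i *: b (x i) w.
  pose g : {linear U -> W} :=
    HB.pack (b^~ w) (GRing.isLinear.Build k U W _ (b^~ w) (bl w)).
  by rewrite -[LHS]/(g _) linear_sum; apply: eq_bigr => i _; rewrite linearZ.
have bsr w (I : finType) (F : I -> k) (x : I -> V) :
    b w (\sum_i F i *: x i) = \sum_i F i *: b w (x i).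
  pose g : {linear V -> W} :=
    HB.pack (b w) (GRing.isLinear.Build k V W _ (b w) (br w)).
  by rewrite -[LHS]/(g _) linear_sum; apply: eq_bigr => i _; rewrite linearZ.
rewrite {2}(coord_vbasis (memvf u)) bsl; apply: eq_bigr => i _.
rewrite {2}(coord_vbasis (memvf v)) bsr scaler_sumr; apply: eq_bigr => j _.
by rewrite !mxE scalerA.
Qed.

Lemma tensor_expand U V (t : tensor U V) :
  t = \sum_i \sum_j t i j *: ((vbasis {:U})`_i \ox (vbasis {:V})`_j).
Proof.
apply/matrixP=> i j; rewrite summxE (bigD1 i) //= summxE (bigD1 j) //=.
have fU := basis_free (vbasisP {:U}); have fV := basis_free (vbasisP {:V}).
rewrite !mxE !(coord_free _ _ fU) !(coord_free _ _ fV) !eqxx !mulr1.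
rewrite big1 => [|j' /negPf nj]; last first.
  by rewrite !mxE !(coord_free _ _ fU) !(coord_free _ _ fV) nj !mulr0.
rewrite big1 ?addr0 // => i' /negPf ni; rewrite summxE big1 // => j' _.
by rewrite !mxE !(coord_free _ _ fU) ni mul0r mulr0.
Qed.

Lemma tensor_ind U V (P : tensor U V -> Prop) :
  P 0 -> (forall c s t, P s -> P t -> P (c *: s + t)) ->
  (forall u v, P (u \ox v)) -> forall t, P t.
Proof.
move=> P0 PD Pp t.
have PA s r : P s -> P r -> P (s + r).
  by move=> Ps Pr; rewrite -[s]scale1r; apply: PD.
rewrite (tensor_expand t); apply: (big_ind P) => // i _.
by apply: (big_ind P) => // j _; rewrite -[X in P X]addr0; apply: PD.
Qed.

Lemma linear_tlift U V W (f : {linear tensor U V -> W}) :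
  f =1 tlift (fun u v => f (u \ox v)).
Proof.
move=> t; rewrite {1}(tensor_expand t) linear_sum; apply: eq_bigr => i _.
by rewrite linear_sum; apply: eq_bigr => j _; rewrite linearZ.
Qed.

HB.instance Definition _ U V U' V' (f : U -> U') (g : V -> V') :=
  GRing.Linear.copy (tmap f g) (tlift (fun u v => f u \ox g v)).
HB.instance Definition _ U V :=
  GRing.Linear.copy (@tswap k U V) (tlift (fun u v => v \ox u)).
HB.instance Definition _ U V W :=
  GRing.Linear.copy (@tassoc k U V W)
    (tlift (fun t w => tlift (fun u v => u \ox (v \ox w)) t)).

Lemma tmap_pure U V U' V' (f : {linear U -> U'}) (g : {linear V -> V'}) u v :
  tmap f g (u \ox v) = f u \ox g v.
Proof.
apply: (tlift_pure (b := fun u v => f u \ox g v)) => w c x y.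
  by rewrite linearP pure_linearl.
by rewrite !linearP.
Qed.

Lemma tswap_pure U V (u : U) (v : V) : tswap (u \ox v) = v \ox u.
Proof.
apply: (tlift_pure (b := fun u v => v \ox u)) => w; last exact: pure_linearl.
exact: pure_linearr.
Qed.

Lemma tassoc_pure U V W (u : U) (v : V) (w : W) :
  tassoc ((u \ox v) \ox w) = u \ox (v \ox w).
Proof.
pose b (t : tensor U V) (w : W) := tlift (fun u v => u \ox (v \ox w)) t.
have bE u' v' w' : b (u' \ox v') w' = u' \ox (v' \ox w').
  apply: (tlift_pure (b := fun u v => u \ox (v \ox w'))) => [v''|u''] c x y.
    exact: pure_linearl.
  by rewrite pure_linearl linearP.
have bl w' : linear (b^~ w') by exact: tlift_linear.
have b0 w' : b 0 w' = 0 by exact: linear0.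
rewrite -[LHS]/(tlift b _) (tlift_pure (b := b)) ?bE // => t c x y.
elim/tensor_ind: t => [|d s r IHs IHr|u' v'].
- by rewrite !b0 scaler0 addr0.
- by rewrite !bl IHs IHr !scalerDr !scalerA mulrC addrACA.
- by rewrite !bE !linearP.
Qed.

Lemma mem_tensorv U V (A : {vspace U}) (B : {vspace V}) u v :
  u \in A -> v \in B -> u \ox v \in tensorv A B.
Proof.
move=> Au Bv; rewrite (coord_vbasis Au) (coord_vbasis Bv).
rewrite linear_sum memv_suml // => j _; rewrite linearZ memvZ //=.
set y := _`_j; pose f : {linear U -> tensor U V} :=
  HB.pack (fun u : U => u \ox y)
    (GRing.isLinear.Build k U (tensor U V) _ _ (pure_linearl y)).
rewrite -[X in X \in _]/(f _) linear_sum memv_suml // => i _.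
rewrite linearZ memvZ //= memv_span //; apply/allpairsP.
by exists ((vbasis A)`_i, y); split=> //=; rewrite mem_nth // size_tuple.
Qed.

End TensorTheory.

(* The algebra A (x) B, with (a (x) b) (a' (x) b') = aa' (x) bb'. *)
Section TensorAlgebra.
Variables (k : fieldType) (A B : falgType k).

Definition tmul (s t : tensor A B) : tensor A B :=
  tlift (fun a b => tlift (fun a' b' => (a * a') \ox (b * b')) t) s.

Fact tmul_linearl t : linear (tmul^~ t).
Proof. exact: tlift_linear. Qed.

Fact tmul_linearr s : linear (tmul s).
Proof.
move=> c x y; rewrite /tmul /tlift scaler_sumr -big_split /=.
apply: eq_bigr => i _; rewrite scaler_sumr -big_split /=; apply: eq_bigr => j _.
set F := fun a' b' => ((vbasis {:A})`_i * a') \ox ((vbasis {:B})`_j * b').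
transitivity (s i j *: (c *: tlift F x + tlift F y)).
  by congr (_ *: _); apply: tlift_linear.
by rewrite scalerDr !scalerA mulrC.
Qed.

Lemma tmul_pure (a a' : A) (b b' : B) :
  tmul (a \ox b) (a' \ox b') = (a * a') \ox (b * b').
Proof.
have E a1 b1 : tlift (fun a' b' => (a1 * a') \ox (b1 * b')) (a' \ox b')
    = (a1 * a') \ox (b1 * b').
  apply: (tlift_pure (b := fun a' b' => (a1 * a') \ox (b1 * b')))
    => [w|w] c x y.
    by rewrite mulrDr -scalerAr pure_linearl.
  by rewrite mulrDr -scalerAr linearP.
transitivity (tlift (fun a b => (a * a') \ox (b * b')) (a \ox b)).
  by apply: eq_bigr => i _; apply: eq_bigr => j _; rewrite E.
apply: (tlift_pure (b := fun a b => (a * a') \ox (b * b'))) => [w|w] c x y.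
  by rewrite mulrDl -scalerAl pure_linearl.
by rewrite mulrDl -scalerAl linearP.
Qed.

Let tmul0l t : tmul 0 t = 0. Proof. exact: linear0. Qed.
Let tmul0r t : tmul t 0 = 0.
Proof. by have := tmul_linearr t 1 0 0; rewrite !scale1r addr0 => /esym/eqP;
  rewrite -[eqbRHS]addr0 (inj_eq (addrI _)) => /eqP. Qed.

Fact tmulA : associative tmul.
Proof.
move=> r s t; elim/tensor_ind: r => [|c r r' IH IH'|a b].
- by rewrite !tmul0l.
- by rewrite !tmul_linearl IH IH'.
elim/tensor_ind: s => [|c s s' IH IH'|a' b'].
- by rewrite !(tmul0l, tmul0r).
- by rewrite !(tmul_linearl, tmul_linearr) IH IH'.
elim/tensor_ind: t => [|c t t' IH IH'|a'' b''].
- by rewrite !tmul0r.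
- by rewrite !tmul_linearr IH IH'.
by rewrite !tmul_pure !mulrA.
Qed.

Fact tmul1l : left_id (1 \ox 1) tmul.
Proof.
elim/tensor_ind=> [|c s t IH IH'|a b]; first by rewrite tmul0r.
  by rewrite tmul_linearr IH IH'.
by rewrite tmul_pure !mul1r.
Qed.

Fact tmul1r : right_id (1 \ox 1) tmul.
Proof.
elim/tensor_ind=> [|c s t IH IH'|a b]; first by rewrite tmul0l.
  by rewrite tmul_linearl IH IH'.
by rewrite tmul_pure !mulr1.
Qed.

Fact tmulDl : left_distributive tmul +%R.
Proof. by move=> x y z; have := tmul_linearl z 1 x y; rewrite !scale1r. Qed.

Fact tmulDr : right_distributive tmul +%R.
Proof. by move=> x y z; have := tmul_linearr x 1 y z; rewrite !scale1r. Qed.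

Fact tensor1_neq0 : (1 : A) \ox (1 : B) != 0.
Proof.
have [i ni] : exists i, coord (vbasis {:A}) i 1 != 0.
  apply/existsP; apply: contraNT (oner_neq0 A) => /existsPn E.
  rewrite (coord_vbasis (memvf 1)) big1 // => i _.
  by rewrite (eqP (negPn (E i))) scale0r.
have [j nj] : exists j, coord (vbasis {:B}) j 1 != 0.
  apply/existsP; apply: contraNT (oner_neq0 B) => /existsPn E.
  rewrite (coord_vbasis (memvf 1)) big1 // => j _.
  by rewrite (eqP (negPn (E j))) scale0r.
apply: contraNneq (mulf_neq0 ni nj) => /matrixP/(_ i j).
by rewrite !mxE => ->.
Qed.

HB.instance Definition _ := GRing.Zmodule_isNzRing.Build (tensor A B)
  tmulA tmul1l tmul1r tmulDl tmulDr tensor1_neq0.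

Lemma pureM (a a' : A) (b b' : B) :
  (a \ox b) * (a' \ox b') = (a * a') \ox (b * b').
Proof. exact: tmul_pure. Qed.

Fact tensor_scaleAl (c : k) (s t : tensor A B) : c *: (s * t) = c *: s * t.
Proof.
by have := tmul_linearl t c s 0; rewrite tmul0l !addr0 => /esym.
Qed.

Fact tensor_scaleAr (c : k) (s t : tensor A B) : c *: (s * t) = s * (c *: t).
Proof.
by have := tmul_linearr s c t 0; rewrite tmul0r !addr0 => /esym.
Qed.

HB.instance Definition _ :=
  GRing.Lmodule_isLalgebra.Build k (tensor A B) tensor_scaleAl.
HB.instance Definition _ :=
  GRing.Lalgebra_isAlgebra.Build k (tensor A B) tensor_scaleAr.

End TensorAlgebra.

(* Finite-dimensional Hopf algebras.  The counit and antipode laws are the    *)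
(* usual Sweedler identities: [tlift b (comul h)] is b(h_(1), h_(2)).         *)
Record hopfType (k : fieldType) := HopfType {
  hopf_algebra :> falgType k;
  comul : {lrmorphism hopf_algebra -> tensor hopf_algebra hopf_algebra};
  counit : {lrmorphism hopf_algebra -> k^o};
  antipode : {linear hopf_algebra -> hopf_algebra};
  comulA : forall h : hopf_algebra,
    tassoc (tmap comul idfun (comul h)) = tmap idfun comul (comul h);
  counitl : forall h : hopf_algebra,
    tlift (fun u v => counit u *: v) (comul h) = h;
  counitr : forall h : hopf_algebra,
    tlift (fun u v => counit v *: u) (comul h) = h;
  antipodel : forall h : hopf_algebra,
    tlift (fun u v => antipode u * v) (comul h) = (counit h)%:A;
  antipoder : forall h : hopf_algebra,
    tlift (fun u v => u * antipode v) (comul h) = (counit h)%:A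
}.

Arguments comul {k h0} : rename.
Arguments counit {k h0} : rename.
Arguments antipode {k h0} : rename.

(* The (possibly infinite) sum of all the subspaces satisfying P. *)
Section SumOfSubspaces.
Variables (k : fieldType) (V : vectType k) (P : {vspace V} -> Prop).

Definition is_sumv (U : {vspace V}) : Prop :=
  (exists2 s : seq {vspace V},
     (forall C, C \in s -> P C) & U = (\sum_(C <- s) C)%VS)
  /\ (forall C, P C -> (C <= U)%VS).

Definition sumv_of : {vspace V} := xget 0%VS is_sumv.

Lemma sumv_ofP : is_sumv sumv_of.
Proof.
apply: xgetPex.
pose Q n := `[< exists2 s : seq {vspace V},
  (forall C, C \in s -> P C) & \dim (\sum_(C <- s) C)%VS = n >].
have exQ : exists n, Q n.
  by exists (\dim (0%VS : {vspace V})); apply/asboolP; exists [::]; rewrite ?big_nil.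
have ubQ n : Q n -> (n <= \dim {:V})%N.
  by move=> /asboolP [s _ <-]; rewrite dimvS ?subvf.
have [n /asboolP [s sP <-] smax] := ex_maxnP exQ ubQ.
exists (\sum_(C <- s) C)%VS; split=> [|C PC]; first by exists s.
have /smax : Q (\dim (\sum_(D <- C :: s) D)%VS).
  apply/asboolP; exists (C :: s) => // D; rewrite inE => /orP[/eqP-> //|].
  exact: sP.
rewrite big_cons => le; have sub := addvSr C (\sum_(D <- s) D)%VS.
by have /eqP-> : (\sum_(D <- s) D == C + \sum_(D <- s) D)%VS
  ; rewrite ?addvSl // eqEdim sub.
Qed.

End SumOfSubspaces.

Section Coradical.
Variables (k : fieldType) (H : hopfType k).

Definition subcoalgebra (C : {vspace H}) : Prop :=
  forall h, h \in C -> comul h \in tensorv C C.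

Definition simple_subcoalgebra (C : {vspace H}) : Prop :=
  [/\ subcoalgebra C, C <> 0%VS &
      forall D, subcoalgebra D -> (D <= C)%VS -> D = 0%VS \/ D = C].

Definition coradical : {vspace H} := sumv_of simple_subcoalgebra.

Definition coradical1 : {vspace H} :=
  (linfun (comul : H -> tensor H H) @^-1:
     (tensorv fullv coradical + tensorv coradical fullv))%VS.

Definition pointed : Prop :=
  forall C, simple_subcoalgebra C -> \dim C = 1%N.

Definition cocommutative : Prop :=
  forall h : H, tswap (comul h) = comul h :> tensor H H.

(* For A, M subspaces of H with AM contained in M, the tensor product over A  *)
(* of the trivial right module k and the left module M is the quotient of     *)
(* k (x) M by the span of the elements eps(h) (x) m - 1 (x) hm (h in A, m in  *)
(* M); a complement of that span in k (x) M stands for the quotient.          *)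
Definition balancing (A M : {vspace H}) : {vspace tensor k^o H} :=
  <<[seq ((counit h : k^o) \ox m) - ((1 : k^o) \ox (h * m))
      | h <- vbasis A, m <- vbasis M]>>%VS.

Definition trivial_tensor (A M : {vspace H}) : {vspace tensor k^o H} :=
  (tensorv fullv M :\: balancing A M)%VS.

Definition has_rank (t : nat) : Prop :=
  \dim (trivial_tensor coradical coradical1) = t.+1.

(* H is generated as an algebra by H_1, a standing assumption of the rank one *)
(* theory that is needed: the dual of k[t]/(t^(p^2)) with t primitive is       *)
(* pointed, cocommutative and of rank one, but it is not some H_F, since its  *)
(* dimension is p^2 and its only group-like element is 1.                     *)
Definition generated_by_coradical1 : Prop := agenv coradical1 = fullv.

End Coradical.

Arguments coradical {k} H.
Arguments coradical1 {k} H.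
Arguments pointed {k} H.
Arguments cocommutative {k} H.
Arguments has_rank {k} H t.
Arguments generated_by_coradical1 {k} H.

Definition hopf_isomorphic (k : fieldType) (H K : hopfType k) : Prop :=
  exists f : {lrmorphism H -> K},
    [/\ bijective f,
        forall h, comul (f h) = tmap f f (comul h) :> tensor K K,
        forall h, counit (f h) = counit h :> k &
        forall h, antipode (f h) = f (antipode h)].

(* A group element g seen in the group algebra kG = {ffun G -> k}. *)
Definition kg (k : fieldType) (G : finGroupType) (g : G) : {ffun G -> k^o} :=
  [ffun h => (h == g)%:R].

(* The tuples F = (G, chi, c, a, (alpha_{-1}, alpha_0)). *)
Record HF_tuple (k : fieldType) (p : nat) := HFTuple {
  HF_group : finGroupType;
  HF_chi : HF_group -> k;
  HF_c : HF_group -> k;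
  HF_a : HF_group;
  HF_alphaN1 : k;
  HF_alpha0 : k;
  HF_a_center : HF_a \in 'Z([set: HF_group])%g;
  HF_chi_neq0 : forall g, HF_chi g != 0;
  HF_chiM : forall g h, HF_chi (g * h)%g = HF_chi g * HF_chi h;
  HF_chi_a : HF_chi HF_a = 1;
  HF_cM : forall h g, HF_c (h * g)%g = HF_chi g * HF_c h + HF_c g;
  HF_c_a : HF_c HF_a = 0;
  HF_alpha0_01 : HF_alpha0 = 0 \/ HF_alpha0 = 1;
  HF_alphaN1_eq0 : HF_alpha0 = 0 -> HF_alphaN1 = 0;
  HF_case0 : HF_alpha0 = 0 -> forall g,
    HF_c g *: (kg k (HF_a ^+ p)%g - kg k 1%g) = 0;
  HF_case1_a : HF_alpha0 = 1 -> (HF_a ^+ p)%g = HF_a;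
  HF_case1_chi : HF_alpha0 = 1 -> forall g,
    exists2 m : nat, (0 < m < p)%N & HF_chi g = m%:R;
  HF_case1_c : HF_alpha0 = 1 -> forall g,
    (HF_alphaN1 * (HF_chi g - 1) + HF_c g ^+ p - HF_c g)
      *: (kg k HF_a - kg k 1%g) = 0
}.

(* K, with the inclusion [iota] of G and the element x, is the Hopf algebra   *)
(* H_F.  The basis and the relations determine its multiplication.            *)
Record is_HF (k : fieldType) (p : nat) (F : HF_tuple k p) (K : hopfType k)
    (iota : HF_group F -> K) (x : K) : Prop := IsHF {
  HF_iota1 : iota 1%g = 1;
  HF_iotaM : forall g h, iota (g * h)%g = iota g * iota h;
  HF_basis : basis_of {:K}
    [seq iota gi.1 * x ^+ gi.2 | gi : HF_group F * 'I_p];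
  HF_xp : x ^+ p = HF_alphaN1 F *: (iota (HF_a F) ^+ p - 1) + HF_alpha0 F *: x;
  HF_conj : forall g,
    iota g * x * iota g^-1%g = HF_chi g *: x + HF_c g *: (iota (HF_a F) - 1);
  HF_comul : forall g (i : 'I_p), comul (iota g * x ^+ i) =
    (iota g \ox iota g) * (x \ox iota (HF_a F) + 1 \ox x) ^+ i :> tensor K K;
  HF_counit : forall g (i : 'I_p),
    counit (iota g * x ^+ i) = (i == 0 :> nat)%:R :> k;
  HF_antipode : forall g (i : 'I_p), antipode (iota g * x ^+ i) =
    (- (x * iota (HF_a F)^-1%g)) ^+ i * iota g^-1%g
}.

(* x is a common eigenvector of G acting by conjugation through [iota]. *)
Definition conj_eigenvector (k : fieldType) (G : finGroupType)
    (K : falgType k) (iota : G -> K) (x : K) : Prop :=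
  x != 0 /\ forall g, exists l : k, iota g * x * iota g^-1%g = l *: x.

(* Main.v *)
Require Import Defs.
From HB Require Import structures.
From mathcomp Require Import all_boot all_order all_algebra all_fingroup.
From mathcomp Require Import all_solvable all_field.
From mathcomp Require Import boolp.

Set Implicit Arguments.
Unset Strict Implicit.
Unset Printing Implicit Defensive.

Import GRing.Theory.
Local Open Scope ring_scope.

(** Cocommutativity makes the coradical filtration transparent.  Each
    functional [f] on [H] acts on [H] by [f . h = f(h_(1)) h_(2)]; these
    operators ([dact]) commute, and the group-like elements are their common
    eigenvectors.  Hence the group-likes form a finite independent set, a
    group [G], and as [H] is pointed they span [H_0].

    Let [e_t] be functionals dual to [G].  If [h] lies in [H_1], a functional
    that kills [H_0] sends [h] into [H_0].  So each
    [w_t = e_t . (e_t . h)] is, modulo the line [k t], an eigenvector with the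
    same eigenvalues as [t], which says that [t^-1 w_t] lies in
    [Q = k 1 + P], where [P] is the space of primitive elements
    ([mem_component]); and [h] differs from the sum of the [w_t] by an element
    of [H_0].  Therefore [H_1] is the direct sum of the [t Q], a free
    [H_0]-module on [Q] ([coradical1E]).

    Freeness makes [k (x)_(H_0) H_1] at least as large as [Q], so rank one
    forces [dim P <= 1] ([dim_primitives1_le]); and [P = 0] would give
    [H_1 = H_0], hence [H = H_0] by generation.  Thus [P = k x].  Now
    [g x g^-1] and [x ^+ p] are primitive, hence multiples of [x]; so [x] is a
    common eigenvector of [G], with character [chi] say, and over an
    algebraically closed field [x] can be rescaled so that [x ^+ p] is [0] or
    [x].  In the second case comparing [(g x g^-1) ^+ p] with
    [g x ^+ p g^-1] gives [chi(g) ^+ p = chi(g)], so [chi(g)] lies in the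
    prime field.

    The [g x ^+ i] with [i < p] span [H], since their span is stable under
    multiplication by [H_1].  They are independent ([pow_independent]): a
    functional [d] with [d(g) = 0] and [d(g x) = 1] sends [g x ^+ i] to
    [i g x ^+ (i-1)] plus lower powers of [x], so the leading coefficients of
    a relation vanish by induction as long as the exponent stays below [p].
    So [H] itself is the Hopf algebra of the tuple [(G, chi, 0, 1, (0, alpha))]
    with [alpha] equal to [0] or [1]. *)

(** * Linear families and tensors *)

Section LinearFamilies.
Variables (k : fieldType) (V : vectType k) (I : finType).

Definition independent (F : I -> V) :=
  forall c : I -> k, \sum_i c i *: F i = 0 -> forall i, c i = 0.

Let nth_codom_rank (F : I -> V) i : (codom_tuple F)`_(enum_rank i) = F i.
Proof.
rewrite -tnth_nth (tnth_nth 0) /= /codom /image_mem.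
by rewrite (nth_map i) -?cardE // -enum_val_nth enum_rankK.
Qed.

Lemma independentE (F : I -> V) : independent F <-> free [seq F i | i : I].
Proof.
pose X := codom_tuple F; have -> : [seq F i | i : I] = X by [].
have XE := nth_codom_rank F.
have sumE (c : I -> k) : \sum_i c i *: F i =
      \sum_(j < #|I|) c (enum_val j) *: X`_j.
  rewrite (reindex _ (onW_bij _ (@enum_val_bij I))) /=.
  by apply: eq_bigr => j _; rewrite -XE enum_valK.
split=> [indF | /freeP freeF c c0 i].
  apply/freeP => c c0 i; have -> : c i = c (enum_rank (enum_val i)).
    by rewrite enum_valK.
  apply: (indF (fun j => c (enum_rank j))); rewrite sumE -[RHS]c0.
  by apply: eq_bigr => j _; rewrite enum_valK.
rewrite -(enum_rankK i); apply: (freeF (c \o enum_val)).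
by rewrite -[RHS]c0 sumE.
Qed.

Lemma independent_functional (F : I -> V) (v : I -> k) :
  independent F -> exists f : 'Hom(V, k^o), forall i, f (F i) = v i.
Proof.
move=> /independentE freeF.
pose X := codom_tuple F.
have XE i : F i = X`_(enum_rank i) by rewrite nth_codom_rank.
exists (\sum_i v i *: linfun (coord X (enum_rank i) : V -> k^o)) => j.
rewrite sum_lfunE (bigD1 j) //= big1 => [|i nij]; rewrite scale_lfunE lfunE /=.
  by rewrite addr0 XE coord_free // eqxx; apply: mulr1.
rewrite XE coord_free // (inj_eq (@enum_rank_inj _)) eq_sym (negPf nij).
exact: mulr0.
Qed.

End LinearFamilies.

Section Contraction.
Variable k : fieldType.
Implicit Types U V W : vectType k.

Lemma tensor_ext U V W (f g : {linear tensor U V -> W}) :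
  (forall u v, f (u \ox v) = g (u \ox v)) -> f =1 g.
Proof.
move=> fg t; rewrite (linear_tlift f) (linear_tlift g).
by apply: eq_bigr => i _; apply: eq_bigr => j _; rewrite fg.
Qed.

Definition purel U V (v : V) (u : U) : tensor U V := u \ox v.

HB.instance Definition _ U V (v : V) :=
  GRing.isLinear.Build k U (tensor U V) _ (@purel U V v) (pure_linearl v).

Lemma pureZl U V (v : V) c (u : U) : (c *: u) \ox v = c *: (u \ox v).
Proof. exact: (linearZZ (purel v)). Qed.

(** Used to verify coassociativity identities on pure tensors only. *)
Lemma tensor3_ext U V W (X : vectType k)
    (f g : {linear tensor (tensor U V) W -> X}) :
  (forall u v w, f ((u \ox v) \ox w) = g ((u \ox v) \ox w)) -> f =1 g.
Proof.
move=> fg; apply: tensor_ext => t w.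
have fgw : f \o purel w =1 g \o purel w by apply: tensor_ext => u v; apply: fg.
exact: fgw.
Qed.

Lemma tensorv_ind U V W (f : {linear tensor U V -> W}) (X : {vspace W})
    (A : {vspace U}) (B : {vspace V}) :
  (forall u v, u \in A -> v \in B -> f (u \ox v) \in X) ->
  forall t, t \in tensorv A B -> f t \in X.
Proof.
move=> fX t tAB.
suff /subvP/(_ t tAB) : (tensorv A B <= linfun f @^-1: X)%VS.
  by rewrite -memv_preim lfunE.
apply/span_subvP=> _ /allpairsP[[u v] [/= Au Bv ->]].
by rewrite -memv_preim lfunE; apply: fX; apply: vbasis_mem.
Qed.

Definition lcontr U V (f : 'Hom(U, k^o)) : tensor U V -> V :=
  tlift (fun u v => f u *: v).

HB.instance Definition _ U V (f : 'Hom(U, k^o)) :=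
  GRing.Linear.copy (@lcontr U V f) (tlift (fun u v => f u *: v)).

Lemma lcontr_pure U V (f : 'Hom(U, k^o)) (u : U) (v : V) :
  lcontr f (u \ox v) = f u *: v.
Proof.
apply: (tlift_pure (b := fun u v => f u *: v)) => w c x y.
  by rewrite linearP scalerDl scalerA.
by rewrite linearP.
Qed.

Lemma lcontr_eq0 U V (t : tensor U V) :
  (forall f : 'Hom(U, k^o), lcontr f t = 0) -> t = 0.
Proof.
move=> t0; apply/matrixP => i j; rewrite mxE.
have freeU := basis_free (vbasisP {:U}).
have freeV := basis_free (vbasisP {:V}).
have := t0 (linfun (coord (vbasis {:U}) i : U -> k^o)).
rewrite /lcontr /tlift (bigD1 i) //= [X in _ + X]big1 => [|i' ni]; last first.
  by rewrite big1 // => j' _; rewrite lfunE /= coord_free // (negPf ni)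
    scale0r scaler0.
rewrite addr0 => t0i; move/freeP: freeV; apply; rewrite -[RHS]t0i.
apply: eq_bigr => j' _; rewrite lfunE /= coord_free // eqxx scale1r.
by [].
Qed.

End Contraction.

(** * The action of the dual algebra *)

Section DualAction.
Variables (k : fieldType) (H : hopfType k).
Implicit Types f : 'Hom(H, k^o).

(** The right action of the dual algebra: [f] sends [h] to
    [f(h_(1)) h_(2)]. *)
Definition dact f : 'End(H) :=
  linfun (@lcontr k H H f \o (comul : H -> tensor H H)).

Lemma dactE f h : dact f h = lcontr f (comul h).
Proof. exact: lfunE. Qed.

(** By coassociativity [dact f] is a morphism of right comodules; this is
    what makes the operators [dact f] closed under composition. *)
Lemma comul_dact f h : comul (dact f h) = tmap (dact f) idfun (comul h).
Proof.
have comulE t : comul (lcontr f t : H) = lcontr f (tmap idfun comul t).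
  apply: (@tensor_ext _ _ _ _ (comul \o @lcontr _ _ _ f)
    (@lcontr _ _ _ f \o tmap (@idfun H) comul)) => u v /=.
  by rewrite tmap_pure !lcontr_pure linearZ.
have assocE (t : tensor (tensor H H) H) :
    lcontr f (tassoc t) = tmap (lcontr f) idfun t.
  apply: (@tensor3_ext _ _ _ _ _ (@lcontr _ _ _ f \o @tassoc _ _ _ _)
    (tmap (@lcontr _ _ _ f) (@idfun H))) => u v w /=.
  rewrite tassoc_pure tmap_pure !lcontr_pure /=.
  by rewrite !lcontr_pure pureZl.
rewrite dactE comulE -comulA assocE.
apply: (@tensor_ext _ _ _ _
   (tmap (@lcontr _ _ _ f) (@idfun H) \o tmap comul idfun)
   (tmap (dact f) (@idfun H))) => u v /=.
by rewrite !tmap_pure /= dactE.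
Qed.

Lemma dact_dact f f' h : dact f' (dact f h) = dact (f' \o dact f)%VF h.
Proof.
rewrite dactE comul_dact dactE.
apply: (@tensor_ext _ _ _ _ (@lcontr _ _ _ f' \o tmap (dact f) (@idfun H))
   (@lcontr _ _ _ (f' \o dact f)%VF)) => u v /=.
by rewrite tmap_pure !lcontr_pure comp_lfunE.
Qed.

Lemma dact_counit h : dact (linfun (counit : H -> k^o)) h = h.
Proof.
rewrite dactE -[RHS]counitl; apply: eq_bigr => i _; apply: eq_bigr => j _.
by rewrite lfunE.
Qed.

(** [dact] with its arguments exchanged, to carry the linearity in [f]. *)
Definition dact_at h f : H := dact f h.

Fact dact_at_linear h : linear (dact_at h).
Proof.
move=> c f f'; rewrite /dact_at !dactE /lcontr /tlift scaler_sumr -big_split.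
apply: eq_bigr => i _; rewrite scaler_sumr -big_split; apply: eq_bigr => j _ /=.
rewrite add_lfunE scale_lfunE scalerDl scalerDr; congr (_ + _).
have scE (a : k^o) (u : H) : (c *: a : k^o) *: u = c *: (a *: u) :> H.
  by rewrite scalerA.
by rewrite scE scalerA mulrC -scalerA.
Qed.

HB.instance Definition _ h :=
  GRing.isLinear.Build k 'Hom(H, k^o) H _ (dact_at h) (dact_at_linear h).

Lemma dactBl f f' h : dact (f - f') h = dact f h - dact f' h.
Proof. exact: (linearB (dact_at h)). Qed.

Lemma dactZl c f h : dact (c *: f) h = c *: dact f h.
Proof. exact: (linearZZ (dact_at h)). Qed.

Lemma dact_suml (I : finType) (F : I -> 'Hom(H, k^o)) h :
  dact (\sum_i F i) h = \sum_i dact (F i) h.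
Proof. exact: (linear_sum (dact_at h)). Qed.

Hypothesis cocommH : cocommutative H.

(** Both sides are [f'(h_(1)) f(h_(2))] up to exchanging the two legs of
    [comul h]. *)
Lemma functional_dactC f f' h : f (dact f' h) = f' (dact f h).
Proof.
rewrite !dactE -{1}cocommH.
apply: (@tensor_ext _ _ _ k^o (f \o @lcontr _ _ _ f' \o @tswap _ _ _)
   (f' \o @lcontr _ _ _ f)) => u v /=.
by rewrite tswap_pure !lcontr_pure !linearZ; apply: mulrC.
Qed.

Lemma dactC f f' h : dact f (dact f' h) = dact f' (dact f h).
Proof.
rewrite !dact_dact; congr (dact _ h); apply/lfunP => {}h.
by rewrite !comp_lfunE functional_dactC.
Qed.

Lemma counit_dact f h : counit (dact f h) = f h :> k.
Proof.
have := functional_dactC (linfun (counit : H -> k^o)) f h.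
by rewrite lfunE /= dact_counit.
Qed.

End DualAction.

(** * Group-like elements *)

Section GroupLikes.
Variables (k : fieldType) (H : hopfType k).
Implicit Types (f : 'Hom(H, k^o)) (g h : H).

Definition grouplike g := comul g = g \ox g :> tensor H H /\ counit g = 1.

Lemma grouplike_neq0 g : grouplike g -> g != 0.
Proof.
case=> _ eg; apply: contra_eq_neq eg => ->.
by rewrite linear0 eq_sym oner_neq0.
Qed.

Lemma dact_grouplike f g : grouplike g -> dact f g = f g *: g.
Proof. by case=> cg _; rewrite dactE cg lcontr_pure. Qed.

Lemma grouplike1 : grouplike 1.
Proof. by split; rewrite rmorph1. Qed.

Lemma grouplikeM g h : grouplike g -> grouplike h -> grouplike (g * h).
Proof.
move=> [cg eg] [ch eh]; split; first by rewrite rmorphM /= cg ch pureM.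
by rewrite rmorphM /= eg eh mul1r.
Qed.

Lemma mul_antipode g : grouplike g -> antipode g * g = 1.
Proof.
case=> cg eg; have := antipodel g; rewrite cg eg scale1r => <-.
rewrite (tlift_pure (b := fun u v : H => antipode u * v)) // => w c x y.
  by rewrite linearP mulrDl scalerAl.
by rewrite mulrDr scalerAr.
Qed.

Lemma antipode_mul g : grouplike g -> g * antipode g = 1.
Proof.
case=> cg eg; have := antipoder g; rewrite cg eg scale1r => <-.
rewrite (tlift_pure (b := fun u v : H => u * antipode v)) // => w c x y.
  by rewrite mulrDl scalerAl.
by rewrite linearP mulrDr scalerAr.
Qed.

(** [comul] preserves inverses, and the inverse of [g (x) g] is
    [S(g) (x) S(g)]. *)
Lemma grouplikeV g : grouplike g -> grouplike (antipode g).
Proof.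
move=> Gg; have [cg eg] := Gg; have gV := antipode_mul Gg.
split; last first.
  by rewrite -[LHS]mul1r -eg -(rmorphM counit) gV rmorph1.
have gVV : (antipode g \ox antipode g : tensor H H) * comul g = 1.
  by rewrite cg pureM mul_antipode.
by rewrite -[LHS]mul1r -gVV -mulrA -rmorphM gV rmorph1 mulr1.
Qed.

(** Group-like elements are common eigenvectors of the dual action with
    pairwise different systems of eigenvalues.  Concretely, if [g] is a
    combination of independent group-likes [s_i], letting the [i]-th coordinate
    functional act on both sides gives [a_i g = a_i s_i]. *)
Lemma grouplike_free (s : seq H) :
  uniq s -> (forall g, g \in s -> grouplike g) -> free s.
Proof.
elim: s => [|g s IHs] /=; first by rewrite nil_free.
case/andP=> gs us Gs; have Gg : grouplike g by apply: Gs; rewrite mem_head.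
have {}Gs h : h \in s -> grouplike h.
  by move=> sh; apply: Gs; rewrite inE sh orbT.
have frees := IHs us Gs; rewrite free_cons frees andbT.
apply: contra gs => /(coord_span (X := in_tuple s)) gE.
have aE i : coord (in_tuple s) i g *: g = coord (in_tuple s) i g *: s`_i.
  pose f : 'Hom(H, k^o) := linfun (coord (in_tuple s) i : H -> k^o).
  have fE h : f h = coord (in_tuple s) i h by rewrite lfunE.
  have ds (j : 'I_(size s)) : dact f s`_j = f s`_j *: s`_j.
    by apply: dact_grouplike; apply: Gs; apply: mem_nth.
  rewrite -[in LHS]fE -dact_grouplike // [in LHS]gE linear_sum (bigD1 i) //=.
  rewrite big1 ?addr0 => [|j nji]; rewrite linearZ /= ds fE coord_free //.
    by rewrite eqxx scale1r.
  by rewrite (negPf nji) scale0r scaler0.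
have [i ai] : exists i, coord (in_tuple s) i g != 0.
  apply/existsP; apply: contraNT (grouplike_neq0 Gg) => /existsPn a0.
  by rewrite gE big1 // => i _; rewrite (eqP (negPn (a0 i))) scale0r.
by rewrite (scalerI ai (aE i)) mem_nth.
Qed.

(** Independence bounds the number of group-likes by [dim H]. *)
Lemma grouplike_enum :
  exists s : seq H, uniq s /\ forall g, g \in s <-> grouplike g.
Proof.
pose Q n := `[< exists s : seq H,
  [/\ uniq s, forall g, g \in s -> grouplike g & size s = n] >].
have exQ : exists n, Q n by exists 0; apply/asboolP; exists [::].
have ubQ n : Q n -> (n <= \dim {:H})%N.
  move=> /asboolP[s [us Gs <-]].
  by rewrite -(eqP (grouplike_free us Gs)) dimvS ?subvf.
have [n /asboolP[s [us Gs <-]] smax] := ex_maxnP exQ ubQ.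
exists s; split=> // g; split=> [|Gg]; first exact: Gs.
apply: contraT => gs; suff /smax : Q (size s).+1 by rewrite ltnn.
apply/asboolP; exists (g :: s); split; rewrite /= ?gs //= => h.
by rewrite inE => /orP[/eqP-> //|]; apply: Gs.
Qed.

Definition grouplikes : seq H := sval (cid grouplike_enum).

Lemma grouplikesP g : g \in grouplikes <-> grouplike g.
Proof. exact: (svalP (cid grouplike_enum)).2. Qed.

Lemma grouplikes_uniq : uniq grouplikes.
Proof. exact: (svalP (cid grouplike_enum)).1. Qed.

Definition glgroup : Type := seq_sub grouplikes.

HB.instance Definition _ := Finite.on glgroup.

(** A rigid synonym of [val], which simplification leaves alone. *)
Definition glval (g : glgroup) : H := val g.

Lemma glval_inj : injective glval. Proof. exact: val_inj. Qed.

Lemma glgroupP (g : glgroup) : grouplike (glval g).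
Proof. exact/grouplikesP/(valP g). Qed.

Definition glgroup_of g (Gg : grouplike g) : glgroup :=
  SeqSub ((grouplikesP g).2 Gg).

Definition gl_mul (g h : glgroup) : glgroup :=
  glgroup_of (grouplikeM (glgroupP g) (glgroupP h)).
Definition gl_one : glgroup := glgroup_of grouplike1.
Definition gl_inv (g : glgroup) : glgroup :=
  glgroup_of (grouplikeV (glgroupP g)).

Fact gl_mulA : associative gl_mul.
Proof. by move=> x y z; apply: val_inj; rewrite /= mulrA. Qed.

Fact gl_mul1 : left_id gl_one gl_mul.
Proof. by move=> x; apply: val_inj; rewrite /= mul1r. Qed.

Fact gl_mulV : left_inverse gl_one gl_inv gl_mul.
Proof.
move=> x; apply: val_inj; rewrite /= mul_antipode //.
exact: glgroupP.
Qed.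

HB.instance Definition _ :=
  Finite_isGroup.Build glgroup gl_mulA gl_mul1 gl_mulV.

Lemma glval1 : glval (1%g : glgroup) = 1. Proof. by []. Qed.

Lemma glvalM (g h : glgroup) : glval (g * h)%g = glval g * glval h.
Proof. by []. Qed.

Lemma glval_mulV (g : glgroup) : glval g * glval (g^-1)%g = 1.
Proof. by rewrite -glvalM mulgV. Qed.

Lemma glval_mulVl (g : glgroup) : glval (g^-1)%g * glval g = 1.
Proof. by rewrite -glvalM mulVg. Qed.

Lemma codom_glval : perm_eq [seq glval g | g : glgroup] grouplikes.
Proof.
apply: uniq_perm; rewrite ?grouplikes_uniq //.
  by rewrite map_inj_uniq ?enum_uniq //; apply: glval_inj.
move=> h; apply/imageP/idP => [[g _ ->]|sh]; first exact: valP g.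
by exists (SeqSub sh).
Qed.

Lemma glval_independent : independent (glval : glgroup -> H).
Proof.
apply/independentE; rewrite (perm_free codom_glval).
by apply: grouplike_free grouplikes_uniq _ => g /grouplikesP.
Qed.

End GroupLikes.

Arguments glval {k H} g : simpl never.

(** * The first two terms of the coradical filtration *)

Section Coradical.
Variables (k : fieldType) (H : hopfType k).
Implicit Types (f : 'Hom(H, k^o)) (h : H).
Local Notation G := (glgroup H).

Definition gl_span : {vspace H} := (\sum_(g : G) <[glval g]>)%VS.

Lemma gl_spanP h :
  reflect (exists c : G -> k, h = \sum_g c g *: glval g)
    (h \in gl_span).
Proof.
apply: (iffP memv_sumP) => [[us usP ->]|[c ->]].
  have /choice[c cE] (g : G) : exists c, us g = c *: glval g.
    exact/vlineP/usP.
  by exists c; apply: eq_bigr => g _.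
by exists (fun g => c g *: glval g) => // g _; apply/vlineP; exists (c g).
Qed.

Lemma glval_gl_span (g : G) : glval g \in gl_span.
Proof. by apply: (subvP (sumv_sup g _ (subvv _))) => //; apply: memv_line. Qed.

Lemma simple_grouplike g : grouplike g -> simple_subcoalgebra <[g : H]>%VS.
Proof.
move=> Gg; have g0 := grouplike_neq0 Gg; split=> [h /vlineP[c ->]||D _ sDg].
- by rewrite linearZ /= Gg.1 memvZ // mem_tensorv // memv_line.
- by move/eqP; rewrite -subv0 -memvE memv0 (negPf g0).
have := dimvS sDg; rewrite dim_vline g0 leq_eqVlt => /orP[dD|].
  by right; apply/eqP; rewrite eqEdim sDg dim_vline g0 (eqP dD).
by rewrite ltnS leqn0 dimv_eq0 => /eqP; left.
Qed.

(** On a line [k v] the coproduct is [v |-> c (v (x) v)], and the counit law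
    forces [c eps(v) = 1]; so [c v] is group-like. *)
Lemma dim1_subcoalgebra (C : {vspace H}) : subcoalgebra C -> \dim C = 1%N ->
  exists2 g, grouplike g & C = <[g]>%VS.
Proof.
move=> subC dC.
pose v := vpick C; have v0 : v != 0 by rewrite vpick0 -dimv_eq0 dC.
have vC : C = <[v]>%VS.
  by apply/eqP; rewrite eq_sym eqEdim -memvE memv_pick dim_vline v0 dC.
have [c cE] : exists c, comul v = c *: (v \ox v) :> tensor H H.
  apply/vlineP; have := subC v; rewrite vC memv_line => /(_ isT).
  apply: (@tensorv_ind _ _ _ _ idfun) => _ _ /vlineP[a ->] /vlineP[b ->] /=.
  by rewrite pureZl linearZ !memvZ // memv_line.
have ecv : c * counit v = 1.
  have := dact_counit v.
  rewrite dactE cE linearZ /= lcontr_pure lfunE /= scalerA => /eqP.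
  rewrite -subr_eq0 -[X in _ - X]scale1r -scalerBl scaler_eq0 (negPf v0).
  by rewrite orbF subr_eq0 => /eqP.
have c0 : c != 0.
  by apply: contraTneq (oner_neq0 k) => c0; rewrite -ecv c0 mul0r eqxx.
exists (c *: v).
  split; first by rewrite linearZ /= cE pureZl [in RHS]linearZ.
  by rewrite linearZ.
rewrite vC; apply/eqP; rewrite eq_sym eqEdim -memvE memvZ ?memv_line //.
by rewrite !dim_vline scaler_eq0 negb_or v0 c0.
Qed.

Lemma pointed_coradical : pointed H ->
  coradical H = gl_span.
Proof.
move=> ptH; have [[s sP sE] Ps] := sumv_ofP (@simple_subcoalgebra k H).
apply/eqP; rewrite eqEsubv; apply/andP; split; last first.
  apply/subv_sumP => g _; apply: Ps; apply: simple_grouplike; exact: glgroupP.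
rewrite /coradical sE; elim: s sP {sE} => [|C s IHs] sP.
  by rewrite big_nil sub0v.
rewrite big_cons subv_add IHs ?andbT => [|D sD]; last first.
  by apply: sP; rewrite inE sD orbT.
have simC : simple_subcoalgebra C by apply: sP; rewrite mem_head.
have [subC _ _] := simC; have [g Gg ->] := dim1_subcoalgebra subC (ptH C simC).
exact: (glval_gl_span (glgroup_of Gg)).
Qed.

Definition primitives : {vspace H} :=
  lker (linfun (comul : H -> tensor H H)
        - linfun (@purel k H H 1) - linfun (@pure k H H 1)).

Lemma primitivesP h :
  reflect (comul h = h \ox 1 + 1 \ox h :> tensor H H) (h \in primitives).
Proof.
rewrite memv_ker !add_lfunE !opp_lfunE !lfunE /= -addrA -opprD subr_eq0.
exact: eqP.
Qed.

Lemma dact_primitive f h : h \in primitives ->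
  dact f h = f h *: 1 + f 1 *: h.
Proof. by move/primitivesP=> ch; rewrite dactE ch linearD /= !lcontr_pure. Qed.

Lemma counit_primitive h : h \in primitives -> counit h = 0.
Proof.
move/(dact_primitive (linfun (counit : H -> k^o))).
rewrite dact_counit !lfunE /= rmorph1 scale1r => /(canLR (addrK _)).
rewrite subrr => /esym/eqP; rewrite scaler_eq0 oner_eq0 orbF.
by move/eqP.
Qed.

Definition primitives1 : {vspace H} := (<[1]> + primitives)%VS.

Lemma primitives1P h :
  reflect (exists c, exists2 y, y \in primitives & h = c *: 1 + y)
    (h \in primitives1).
Proof.
apply: (iffP memv_addP) => [[_ /vlineP[c ->] [y Py ->]]|[c [y Py ->]]].
  by exists c; exists y.
by exists (c *: 1); [apply/vlineP; exists c | exists y].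
Qed.

Definition component (g : G) : {vspace H} :=
  (amull (glval g) @: primitives1)%VS.

Lemma componentP (g : G) h :
  reflect (exists2 q, q \in primitives1 & h = glval g * q) (h \in component g).
Proof.
apply: (iffP memv_imgP) => [[q Qq ->]|[q Qq ->]]; exists q => //.
all: by rewrite lfunE.
Qed.

Lemma dim_component (g : G) : \dim (component g) = \dim primitives1.
Proof.
apply: limg_dim_eq; apply/eqP; rewrite -subv0; apply/subvP => h.
rewrite memv_cap memv_ker lfunE memv0 => /andP[_ /eqP /= gh0].
by rewrite -[h]mul1r -(glval_mulVl g) -mulrA gh0 mulr0.
Qed.

Lemma comul_component (g : G) (y : H) : y \in primitives ->
  comul (glval g * y) = (glval g * y) \ox glval g + glval g \ox (glval g * y)
    :> tensor H H.
Proof.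
move/primitivesP=> cy; rewrite rmorphM /= cy (glgroupP g).1 mulrDr !pureM.
by rewrite !mulr1.
Qed.

(** Elements of [g Q] are eigenvectors of the dual action modulo the line
    [k g], with the eigenvalues of [g].  When [H] is cocommutative this
    characterizes [g Q], see [mem_component]. *)
Lemma dact_component f (g : G) w : w \in component g ->
  dact f w - f (glval g) *: w \in <[glval g]>%VS.
Proof.
case/componentP=> _ /primitives1P[c [y Py ->]] ->.
have dy : dact f (glval g * y) =
    f (glval g * y) *: glval g + f (glval g) *: (glval g * y).
  by rewrite dactE comul_component // linearD /= !lcontr_pure.
rewrite mulrDr -scalerAr mulr1 linearD linearZ /= dy dact_grouplike; last first.
  exact: glgroupP.
apply/vlineP; exists (f (glval g * y)).
rewrite scalerDr !scalerA [f _ * c]mulrC opprD addrACA subrr add0r.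
by rewrite addrK.
Qed.

Hypothesis cocommH : cocommutative H.

(** Subtract [eps(w) g] to get [w'] of counit [0], with
    [f . w' = f(g) w' + l_f g].  Applying the counit identifies [l_f] as
    [f(w')], and the equation for all [f] says that
    [comul w' = w' (x) g + g (x) w'], i.e. that [g^-1 w'] is primitive. *)
Lemma mem_component (g : G) w :
  (forall f, dact f w - f (glval g) *: w \in <[glval g]>%VS) ->
  w \in component g.
Proof.
move=> wP; pose w' := w - counit w *: glval g.
have Gg := glgroupP g; have eg := Gg.2.
have ew' : counit w' = 0.
  rewrite linearB linearZ /= eg; apply/eqP; rewrite subr_eq0; apply/eqP.
  exact/esym/mulr1.
have dw' f : dact f w' = f (glval g) *: w' + f w' *: glval g.
  have : dact f w' - f (glval g) *: w' \in <[glval g]>%VS.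
    have -> : dact f w' - f (glval g) *: w' = dact f w - f (glval g) *: w.
      have -> : dact f w' = dact f w - counit w *: (f (glval g) *: glval g).
        by rewrite linearB linearZ /= (dact_grouplike f Gg).
      rewrite scalerBr !scalerA.
      by rewrite [f _ * _]mulrC opprB addrA subrK.
    exact: wP.
  case/vlineP=> l lE; rewrite -[LHS](subrK (f (glval g) *: w')) lE addrC.
  congr (_ + _ *: _).
  have := congr1 counit lE; rewrite linearB !linearZ /= ew' eg counit_dact //.
  by rewrite oppr0 scaler0 addr0 => ->; apply/esym/mulr1.
have cw' : comul w' = w' \ox glval g + glval g \ox w' :> tensor H H.
  apply/eqP; rewrite -subr_eq0; apply/eqP/lcontr_eq0 => f.
  rewrite [lcontr f _]linearB /= [X in _ - X]linearD /= !lcontr_pure -dactE.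
  by rewrite dw' [f w' *: _ + _]addrC subrr.
apply/componentP; exists (counit w *: 1 + glval (g^-1)%g * w').
  apply/primitives1P; exists (counit w); exists (glval (g^-1)%g * w') => //.
  apply/primitivesP; rewrite rmorphM /= cw' (glgroupP (g^-1)%g).1 mulrDr !pureM.
  by rewrite glval_mulVl.
by rewrite mulrDr -scalerAr mulr1 mulrA glval_mulV mul1r addrC subrK.
Qed.

Lemma dual_basis :
  exists e : G -> 'Hom(H, k^o), forall t g, e t (glval g) = (t == g)%:R.
Proof.
have ex t : exists f : 'Hom(H, k^o), forall g : G, f (glval g) = (t == g)%:R.
  exact: independent_functional (@glval_independent k H).
by have [e eE] := choice ex; exists e.
Qed.

(** The functionals that kill [H_0] form the radical of the dual algebra, and
    [H_1] is the annihilator of its square. *)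
Lemma dact_coradical1 f h : pointed H -> (forall g : G, f (glval g) = 0) ->
  h \in coradical1 H -> dact f h \in coradical H.
Proof.
move=> ptH f0; rewrite -memv_preim lfunE /= => /memv_addP[s sP [r rP hE]].
rewrite dactE hE linearD memvD //=.
  by apply: tensorv_ind sP => u v _ Hv /=; rewrite lcontr_pure memvZ.
apply: tensorv_ind rP => u v Hu _ /=; rewrite lcontr_pure.
move: Hu; rewrite pointed_coradical // => /gl_spanP[c ->].
rewrite linear_sum big1 ?scale0r ?mem0v // => g _.
by rewrite linearZ /= f0 scaler0.
Qed.

Lemma dact_dual (e : G -> 'Hom(H, k^o)) (t : G) h :
  (forall t g : G, e t (glval g) = (t == g)%:R) ->
  h \in gl_span -> dact (e t) h \in <[glval t]>%VS.
Proof.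
move=> eE /gl_spanP[c ->]; rewrite linear_sum memv_suml // => g _.
rewrite linearZ /= dact_grouplike ?eE; last exact: glgroupP.
case: eqP => [->|_]; first by rewrite scale1r memvZ ?memv_line.
by rewrite scale0r scaler0 mem0v.
Qed.

Lemma glval_component (g : G) : glval g \in component g.
Proof.
apply/componentP; exists 1; last by rewrite mulr1.
by apply/primitives1P; exists 1, 0; rewrite ?mem0v // scale1r addr0.
Qed.

(** The [e_t] are orthogonal idempotents modulo the functionals that kill
    [H_0].  So for [h] in [H_1] the square of [e_t] isolates a part of [h] in
    [t Q], and the sum of these squares is the identity modulo [H_0]. *)
Lemma coradical1_sub_components : pointed H ->
  (coradical1 H <= \sum_(g : G) component g)%VS.
Proof.
move=> ptH; apply/subvP => h Hh; have [e eE] := dual_basis.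
pose w t := dact (e t) (dact (e t) h).
have wP t : w t \in component t.
  apply: mem_component => f.
  (* [f] commutes past the first [e_t] and then [f e_t - f(t) e_t] kills
     [H_0], so it sends [h] into [H_0], which [e_t] projects to [k t]. *)
  pose f0 := (f \o dact (e t))%VF - f (glval t) *: e t.
  have -> : dact f (w t) - f (glval t) *: w t = dact (e t) (dact f0 h).
    rewrite dactBl dactZl -dact_dact.
    rewrite (linearB (dact (e t))) (linearZZ (dact (e t))) /w.
    by rewrite (dactC cocommH f).
  apply: dact_dual => //; rewrite -pointed_coradical //.
  apply: dact_coradical1 => // g; rewrite /f0 add_lfunE opp_lfunE scale_lfunE.
  rewrite comp_lfunE (dact_grouplike _ (glgroupP g)) linearZ /= eE.
  apply/eqP; rewrite subr_eq0; apply/eqP.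
  case: eqP => [->|_] /=; first by rewrite scale1r; apply/esym/mulr1.
  by rewrite scale0r; apply/esym/mulr0.
rewrite -[h](subrK (\sum_t w t)) memvD //; last first.
  by rewrite memv_suml // => t _; apply: (subvP (sumv_sup t _ (subvv _))).
have : h - \sum_t w t \in coradical H.
  pose f0 := linfun (counit : H -> k^o) - \sum_t (e t \o dact (e t))%VF.
  have -> : h - \sum_t w t = dact f0 h.
    rewrite dactBl dact_counit; congr (_ - _).
    rewrite dact_suml; apply: eq_bigr => t _.
    by rewrite -dact_dact.
  apply: dact_coradical1 => // g; rewrite /f0 add_lfunE opp_lfunE sum_lfunE.
  rewrite lfunE /= (glgroupP g).2 (bigD1 g) //= big1 => [|t ntg].
    rewrite addr0 comp_lfunE dact_grouplike; last exact: glgroupP.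
    by rewrite linearZ /= eE eqxx scale1r subrr.
  rewrite comp_lfunE dact_grouplike; last exact: glgroupP.
  by rewrite linearZ /= eE (negPf ntg) scale0r.
rewrite pointed_coradical //; apply: subvP; apply/subv_sumP => g _.
rewrite -memvE; apply: (subvP (sumv_sup g _ (subvv _))) => //.
exact: glval_component.
Qed.

Lemma component_sub (g : G) : pointed H -> (component g <= coradical1 H)%VS.
Proof.
move=> ptH; apply/subvP => _ /componentP[_ /primitives1P[c [y Py ->]] ->].
have G0 : glval g \in coradical H by rewrite pointed_coradical // glval_gl_span.
rewrite -memv_preim lfunE /= mulrDr -scalerAr mulr1 linearD linearZ /=.
rewrite comul_component // (glgroupP g).1 addrA memv_add //.
  by rewrite memvD ?memvZ // mem_tensorv ?memvf.
by rewrite mem_tensorv ?memvf.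
Qed.

(** Write the primitive [h] as the sum of [c_t t].  Then [e_t] sends [h] to
    [c_t t], but also to [c_t 1] if [t <> 1]; so [h] is a multiple of [1], and
    its counit vanishes. *)
Lemma primitive_gl_span_eq0 h : h \in primitives ->
  h \in gl_span -> h = 0.
Proof.
move=> Ph /gl_spanP[c hE]; have [e eE] := dual_basis.
have c0 (t : G) : t != 1%g -> c t = 0.
  move=> t1; apply: contraNeq t1 => ct.
  have dh : dact (e t) h = c t *: glval t.
    rewrite hE linear_sum (bigD1 t) //= big1 ?addr0 => [|g ngt].
      rewrite linearZ /= dact_grouplike ?eE ?eqxx ?scale1r //.
      exact: glgroupP.
    rewrite linearZ /= dact_grouplike ?eE; last exact: glgroupP.
    by rewrite eq_sym (negPf ngt) scale0r scaler0.
  have eh : e t h = c t.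
    rewrite -[LHS](counit_dact cocommH) dh linearZ /= (glgroupP t).2.
    exact: mulr1.
  apply: contraT => t1; case/negP: ct; apply/eqP.
  move: dh; rewrite dact_primitive // -glval1 eE (negPf t1) scale0r addr0 eh.
  move/eqP; rewrite -subr_eq0 -scalerBr scaler_eq0 => /orP[/eqP //|].
  by rewrite subr_eq0 (inj_eq (@glval_inj k H)) eq_sym (negPf t1).
have := counit_primitive Ph; rewrite hE (bigD1 1%g) //= big1 => [|g /c0->].
  rewrite addr0 linearZ /= glval1 rmorph1 => c1.
  by rewrite -[c 1%g]mulr1 [c _ * _]c1 scale0r.
by rewrite scale0r.
Qed.

Lemma component_gl_span (g : G) w : w \in component g ->
  w \in gl_span -> w \in <[glval g]>%VS.
Proof.
case/componentP=> _ /primitives1P[c [y Py ->]] ->.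
rewrite mulrDr -scalerAr mulr1 => sw.
suff -> : y = 0 by rewrite mulr0 addr0 memvZ ?memv_line.
apply: primitive_gl_span_eq0 Py _.
have : glval g * y \in gl_span.
  rewrite -[glval g * y](addKr (c *: glval g)) memvD // -scaleNr memvZ //.
  exact: glval_gl_span.
move/gl_spanP=> [d dE].
rewrite -[y]mul1r -(glval_mulVl g) -mulrA dE mulr_sumr memv_suml // => h _.
by rewrite -scalerAr -glvalM memvZ ?glval_gl_span.
Qed.

(** In a relation [sum_g u_g = 0], acting by [e_t] isolates [u_t] modulo
    [k G]; so every [u_t] lies in [k t], and the [t] are independent. *)
Lemma component_direct : directv (\sum_(g : G) component g).
Proof.
apply/directv_sum_independent => us usP us0; have [e eE] := dual_basis.
have us_line t : us t \in <[glval t]>%VS.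
  apply: component_gl_span; first exact: usP.
  have : dact (e t) (\sum_g us g) - us t \in gl_span.
    have -> : us t = \sum_g (e t (glval g)) *: us g.
      rewrite (bigD1 t) //= eE eqxx scale1r big1 ?addr0 // => g ngt.
      by rewrite eE eq_sym (negPf ngt) scale0r.
    rewrite linear_sum -sumrB memv_suml // => g _.
    apply: (subvP (sumv_sup g _ (subvv _))) => //.
    exact: dact_component (usP g isT).
  by rewrite us0 linear0 sub0r memvN.
have /choice[c cE] t : exists c, us t = c *: glval t by apply/vlineP.
have c0 : forall t, c t = 0.
  apply: glval_independent; rewrite -[RHS]us0; apply: eq_bigr => t _.
  exact/esym/cE.
by move=> t _; rewrite cE c0 scale0r.
Qed.

Lemma coradical1E : pointed H -> coradical1 H = (\sum_(g : G) component g)%VS.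
Proof.
move=> ptH; apply/eqP; rewrite eqEsubv coradical1_sub_components //=.
by apply/subv_sumP => g _; apply: component_sub.
Qed.

Lemma dim_coradical1 : pointed H ->
  \dim (coradical1 H) = (#|{: G}| * \dim primitives1)%N.
Proof.
move=> ptH; rewrite coradical1E // (directvP component_direct) /=.
by rewrite (eq_bigr _ (fun g _ => dim_component g)) sum_nat_const.
Qed.

End Coradical.

(** * Rank one *)

Section RankOne.
Variables (k : fieldType) (H : hopfType k).
Hypotheses (cocommH : cocommutative H) (pointedH : pointed H).
Local Notation G := (glgroup H).
Local Notation Q := (primitives1 H).

(** The subspace [H_0^+ H_1], where [H_0^+] is the augmentation ideal of
    [H_0 = k G]: it is spanned by the [(g - 1) q] since
    [(g - 1) t q = (g t - 1) q - (t - 1) q]. *)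
Definition augmentation_image : {vspace H} :=
  (\sum_(g : G | g != 1%g) amull (glval g - 1)%R @: Q)%VS.

Lemma mem_augmentation (g : G) (q : H) : q \in Q ->
  (glval g - 1) * q \in augmentation_image.
Proof.
move=> Qq; have [->|g1] := eqVneq g 1%g.
  by rewrite glval1 subrr mul0r mem0v.
apply: (subvP (sumv_sup g g1 (subvv _))).
by apply/memv_imgP; exists q; rewrite ?lfunE.
Qed.

Lemma dim_augmentation :
  (\dim augmentation_image <= #|{: G}|.-1 * \dim Q)%N.
Proof.
apply: leq_trans (dimv_leq_sum _ _ _) _.
apply: (@leq_trans (\sum_(g : G | g != 1%g) \dim Q)%N).
  apply: leq_sum => g _.
  by rewrite -(limg_ker_dim (amull (glval g - 1)) Q) leq_addl.
by rewrite sum_nat_const leq_mul2r -(cardC1 (1%g : G)) leqnn orbT.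
Qed.

Lemma augmentationP (h m : H) : h \in coradical H -> m \in coradical1 H ->
  (counit h : k) *: m - h * m \in augmentation_image.
Proof.
rewrite pointed_coradical // => /gl_spanP[c ->] Hm.
rewrite linear_sum scaler_suml mulr_suml -sumrB memv_suml // => g _.
rewrite linearZ /= (glgroupP g).2 -scalerAl.
have -> : (c g *: (1 : k^o) : k) = c g by apply: mulr1.
rewrite -scalerBr memvZ //.
move: Hm; rewrite coradical1E // => /memv_sumP[us usP ->].
rewrite mulr_sumr -sumrB memv_suml // => t _.
have /componentP[q Qq ->] := usP t isT.
have -> : glval t * q - glval g * (glval t * q) =
    (glval t - 1) * q - (glval (g * t)%g - 1) * q.
  by rewrite !mulrBl mul1r opprB addrA subrK glvalM mulrA.
by rewrite memvB // mem_augmentation.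
Qed.

(** The balancing relations fill [1 (x) H_0^+ H_1], of dimension at most
    [(|G| - 1) dim Q], in a space that contains [1 (x) H_1], of dimension
    [|G| dim Q].  So the quotient has dimension at least [dim Q]. *)
Lemma dim_primitives1_le t : has_rank H t -> (\dim Q <= t.+1)%N.
Proof.
rewrite /has_rank /trivial_tensor; set T := tensorv _ _; set B := balancing _ _.
pose j := linfun (@pure k k^o H 1).
have jK : cancel j (lcontr (linfun (@idfun k^o))).
  by move=> h; rewrite lfunE /= lcontr_pure lfunE /= scale1r.
have kerj (U : {vspace H}) : (U :&: lker j)%VS = 0%VS.
  apply/eqP; rewrite -subv0; apply/subvP => h.
  rewrite memv_cap memv_ker memv0 => /andP[_ /eqP jh].
  by rewrite -[h]jK jh linear0.
have leB : (\dim B <= #|{: G}|.-1 * \dim Q)%N.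
  apply: leq_trans dim_augmentation; rewrite -(limg_dim_eq (kerj _)).
  apply: dimvS; apply/span_subvP => _ /allpairsP[[h m] [/= Hh Hm ->]].
  apply/memv_imgP; exists ((counit h : k) *: m - h * m).
    by apply: augmentationP; apply: vbasis_mem.
  rewrite lfunE linearB linearZ /=; congr (_ - _).
  by rewrite -pureZl; congr (_ \ox _); apply/esym/mulr1.
have leT : (#|{: G}| * \dim Q <= \dim T)%N.
  rewrite -dim_coradical1 // -(limg_dim_eq (kerj _)); apply: dimvS.
  apply/subvP => _ /memv_imgP[m Hm ->].
  by rewrite lfunE mem_tensorv ?memvf.
move=> dTB; have := dimv_cap_compl T B; rewrite dTB => dT.
have leTB : (\dim (T :&: B) <= \dim B)%N by rewrite dimvS // capvSr.
have G0 : (0 < #|{: G}|)%N by apply/card_gt0P; exists 1%g.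
move: leT; rewrite -dT -(prednK G0) mulSn => leT.
rewrite -(leq_add2r (#|{: G}|.-1 * \dim Q)%N) (leq_trans leT) //.
rewrite addnC leq_add2l.
exact: leq_trans leTB leB.
Qed.

Lemma dim_primitives1 : \dim Q = (\dim (primitives H)).+1.
Proof.
rewrite /primitives1 dimv_disjoint_sum ?dim_vline ?oner_eq0 //.
apply/eqP; rewrite -subv0; apply/subvP => _ /memv_capP[/vlineP[c ->] Pc].
have := counit_primitive Pc; rewrite linearZ /= rmorph1 => c1.
by rewrite memv0 -[c]mulr1 [c * 1]c1 scale0r.
Qed.

Lemma gl_spanM (h h' : H) :
  h \in gl_span H -> h' \in gl_span H ->
  h * h' \in gl_span H.
Proof.
move=> /gl_spanP[c ->] /gl_spanP[c' ->].
rewrite mulr_suml memv_suml // => g _; rewrite mulr_sumr memv_suml // => g' _.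
by rewrite -scalerAl -scalerAr !memvZ // -glvalM glval_gl_span.
Qed.

(** Without primitive elements [H_1] reduces to the subalgebra [H_0]. *)
Lemma primitives_neq0 : generated_by_coradical1 H ->
  coradical H <> fullv -> primitives H != 0%VS.
Proof.
move=> genH; apply: contra_not_neq => P0.
have H10 : (coradical1 H <= coradical H)%VS.
  rewrite coradical1E // pointed_coradical //; apply/subv_sumP => g _.
  apply/subvP => _ /componentP[_ /primitives1P[c [y + ->]] ->].
  rewrite P0 memv0 => /eqP->.
  by rewrite addr0 -scalerAr mulr1 memvZ ?glval_gl_span.
apply/eqP; rewrite eqEsubv subvf /= -genH; apply: agenv_sub_modl.
  by rewrite -memvE pointed_coradical // -(glval1 H) glval_gl_span.
apply/prodvP => h h' /(subvP H10).
rewrite pointed_coradical //; exact: gl_spanM.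
Qed.

Lemma rank1_primitives : generated_by_coradical1 H -> coradical H <> fullv ->
  has_rank H 1 -> exists2 x : H, x != 0 & primitives H = <[x]>%VS.
Proof.
move=> genH neH /dim_primitives1_le; rewrite dim_primitives1 ltnS => dP.
pose x := vpick (primitives H).
have x0 : x != 0 by rewrite vpick0 primitives_neq0.
exists x => //; apply/eqP; rewrite eq_sym eqEdim -memvE memv_pick dim_vline x0.
exact: dP.
Qed.

End RankOne.

(** * Powers of a primitive element *)

Section PrimitivePowers.
Variables (k : fieldType) (H : hopfType k).
Local Notation G := (glgroup H).

Lemma comul_powE (x : H) (g : G) i : x \in primitives H ->
  comul (glval g * x ^+ i) =
    (glval g \ox glval g) * (x \ox 1 + 1 \ox x) ^+ i :> tensor H H.
Proof.
by move/primitivesP=> cx; rewrite rmorphM rmorphXn /= cx (glgroupP g).1.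
Qed.

Lemma pureX (a b : H) i : (a \ox b : tensor H H) ^+ i = (a ^+ i) \ox (b ^+ i).
Proof. by elim: i => [//|i IHi]; rewrite !exprS IHi pureM. Qed.

Lemma comm_legs (x : H) :
  GRing.comm (x \ox 1 : tensor H H) (1 \ox x : tensor H H).
Proof. by rewrite /GRing.comm !pureM !mulr1 !mul1r. Qed.

Lemma comul_pow (x : H) (g : G) i : x \in primitives H ->
  comul (glval g * x ^+ i) = \sum_(j < i.+1)
    ((glval g * x ^+ (i - j)) \ox (glval g * x ^+ j)) *+ 'C(i, j) :> tensor H H.
Proof.
move/comul_powE=> ->; rewrite (exprDn_comm _ (comm_legs x)) mulr_sumr.
apply: eq_bigr => j _; rewrite mulrnAr; congr (_ *+ _).
by rewrite !pureX !expr1n !pureM mulr1 mul1r.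
Qed.

Lemma counit_pow (x : H) (g : G) i : x \in primitives H ->
  counit (glval g * x ^+ i) = (i == 0)%:R :> k.
Proof.
move/counit_primitive=> ex; rewrite rmorphM rmorphXn /= ex (glgroupP g).2.
by rewrite mul1r expr0n.
Qed.

(** Both [S] and the claimed formula are right convolution inverses of the
    identity on [g x ^+ i]: for the formula this is the binomial expansion of
    [(x - x) ^+ i].  The two convolutions agree term by term for exponents
    below [i], hence also at [i]. *)
Lemma antipode_pow (x : H) (g : G) i : x \in primitives H ->
  antipode (glval g * x ^+ i) = (- x) ^+ i * glval g^-1%g.
Proof.
move=> Px; elim/ltn_ind: i => i IHi.
have mulE (u v : H) :
    tlift (fun u v : H => u * antipode v) (u \ox v) = u * antipode v.
  rewrite (tlift_pure (b := fun u v : H => u * antipode v)) // => w c a b.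
    by rewrite mulrDl scalerAl.
  by rewrite linearP mulrDr scalerAr.
have convE : \sum_(j < i.+1) (glval g * x ^+ (i - j))
    * antipode (glval g * x ^+ j) *+ 'C(i, j) = (i == 0)%:R.
  have := antipoder (glval g * x ^+ i).
  rewrite counit_pow // comul_pow // linear_sum /= => bE.
  transitivity ((i == 0)%:R%:A : H); last first.
    by case: (i == 0); rewrite ?scale1r ?scale0r.
  by rewrite -bE; apply: eq_bigr => j _; rewrite raddfMn /= mulE.
have binE : \sum_(j < i.+1) (glval g * x ^+ (i - j))
    * ((- x) ^+ j * glval g^-1%g) *+ 'C(i, j) = (i == 0)%:R.
  have commx : GRing.comm x (- x) by apply/commrN.
  have := exprDn_comm i commx; rewrite subrr expr0n => bE.
  transitivity (glval g * (i == 0)%:R * glval g^-1%g); last first.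
    by case: (i == 0); rewrite ?mulr1 ?glval_mulV ?mulr0 ?mul0r.
  rewrite bE mulr_sumr mulr_suml; apply: eq_bigr => j _.
  by rewrite mulrnAr mulrnAl !mulrA.
move: convE; rewrite -binE !big_ord_recr /= !subnn !binn !mulr1n !mulr1.
rewrite (eq_bigr (fun j : 'I_i => glval g * x ^+ (i - j)
    * ((- x) ^+ j * glval g^-1%g) *+ 'C(i, j))) => [|j _]; last by rewrite IHi.
move/addrI => E.
by rewrite -[LHS]mul1r -(glval_mulVl g) -mulrA E mulrA glval_mulVl mul1r.
Qed.

Lemma primitive_conj (x : H) (g : G) : x \in primitives H ->
  glval g * x * glval g^-1%g \in primitives H.
Proof.
move/primitivesP=> cx; apply/primitivesP.
rewrite !rmorphM /= cx (glgroupP g).1 (glgroupP g^-1%g).1 mulrDr mulrDl !pureM.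
by rewrite !mulr1 glval_mulV.
Qed.

Variable p : nat.
Hypothesis pchark : p \in [pchar k].

(** The Frobenius map is additive on the commuting elements [x (x) 1] and
    [1 (x) x]. *)
Lemma primitive_pchar (x : H) : x \in primitives H -> x ^+ p \in primitives H.
Proof.
move/primitivesP=> cx; apply/primitivesP.
have pcharT : p \in [pchar (tensor H H)] by rewrite pchar_lalg.
rewrite rmorphXn /= cx.
have := pFrobenius_autD_comm pcharT (comm_legs x).
by rewrite !pFrobenius_autE !pureX !expr1n.
Qed.

Hypotheses (cocommH : cocommutative H) (pointedH : pointed H).
Variables (x : H) (beta : k).
Hypotheses (x_neq0 : x != 0) (primE : primitives H = <[x]>%VS).
Hypothesis xp : x ^+ p = beta *: x.

Let Px : x \in primitives H. Proof. by rewrite primE memv_line. Qed.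
Let p_gt1 : (1 < p)%N. Proof. exact: prime_gt1 (pcharf_prime pchark). Qed.

Lemma gl_x_independent :
  independent (fun gb : G * bool => glval gb.1 * x ^+ gb.2).
Proof.
move=> c c0.
have : \sum_(g : G) glval g * (c (g, false) *: 1 + c (g, true) *: x) = 0.
  transitivity (\sum_(g : G) \sum_(b : bool) c (g, b) *: (glval g * x ^+ b)).
    apply: eq_bigr => g _; rewrite big_bool /= expr0 expr1 mulrDr -!scalerAr.
    by rewrite addrC.
  by rewrite pair_bigA -[RHS]c0; apply: eq_bigr => -[g b] _.
pose us (g : G) : H := glval g * (c (g, false) *: 1 + c (g, true) *: x).
move=> s0; have {s0} us0 : forall g, us g = 0.
  move=> g; have /directv_sum_independent/(_ us) := component_direct cocommH.
  apply=> // t _; apply/componentP.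
  exists (c (t, false) *: 1 + c (t, true) *: x) => //.
  apply/primitives1P; exists (c (t, false)), (c (t, true) *: x) => //.
  by rewrite memvZ.
move=> [g b].
have {us0} E : c (g, false) *: 1 + c (g, true) *: x = 0.
  have := us0 g; rewrite /us => /(congr1 ( *%R (glval g^-1%g))).
  by rewrite mulrA glval_mulVl mul1r mulr0.
have cf0 : c (g, false) = 0.
  have := congr1 counit E; rewrite linearD !linearZ /= (counit_primitive Px).
  rewrite rmorph1 scaler0 addr0 rmorph0.
  by move=> E'; rewrite -[LHS]mulr1; apply: E'.
case: b => //; move/eqP: E; rewrite cf0 scale0r add0r scaler_eq0 (negPf x_neq0).
by rewrite orbF => /eqP.
Qed.

(** Acting by such a [d] lowers the degree in [x] by one, like a derivation
    with respect to [x]; see [dact_pow]. *)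
Lemma derivation_functional : exists d : 'Hom(H, k^o),
  forall g : G, d (glval g) = 0 /\ d (glval g * x) = 1.
Proof.
have [d dE] :=
  independent_functional (fun gb : G * bool => gb.2%:R) gl_x_independent.
exists d => g; have := dE (g, true); have := dE (g, false).
by rewrite /= expr0 expr1 mulr1.
Qed.

Definition deg_lt m : {vspace H} :=
  (\sum_(i < m) \sum_(g : G) <[glval g * x ^+ i]>)%VS.

Lemma mem_deg_lt m i (g : G) : (i < m)%N -> glval g * x ^+ i \in deg_lt m.
Proof.
move=> im; apply: (subvP (sumv_sup (Ordinal im) _ (subvv _))) => //.
by apply: (subvP (sumv_sup g _ (subvv _))) => //=; apply: memv_line.
Qed.

Lemma deg_lt_ind m (f : 'End(H)) (X : {vspace H}) :
  (forall i g, (i < m)%N -> f (glval g * x ^+ i) \in X) ->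
  forall h, h \in deg_lt m -> f h \in X.
Proof.
move=> fX h Hh; rewrite memv_preim; apply: subvP Hh.
apply/subv_sumP => i _; apply/subv_sumP => g _.
by rewrite -memvE -memv_preim; apply: fX.
Qed.

Lemma deg_ltS m n : (m <= n)%N -> (deg_lt m <= deg_lt n)%VS.
Proof.
move=> mn; apply/subvP => h Hh; rewrite -[h]id_lfunE.
apply: deg_lt_ind Hh => i g im.
by rewrite id_lfunE mem_deg_lt // (leq_trans im).
Qed.

Section Derivation.
Variable d : 'Hom(H, k^o).
Hypotheses (d0 : forall g : G, d (glval g) = 0).
Hypotheses (d1 : forall g : G, d (glval g * x) = 1).

Lemma dact_pow (g : G) i :
  dact d (glval g * x ^+ i.+1) - i.+1%:R *: (glval g * x ^+ i) \in deg_lt i.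
Proof.
rewrite dactE comul_pow // linear_sum 2!big_ord_recr /=.
rewrite !raddfMn /= !lcontr_pure.
rewrite subnn subSnn expr0 expr1 mulr1 d0 d1 scale0r mul0rn addr0 scale1r.
(* The last two terms of the binomial sum have been isolated: the exponent 0
   is killed by [d], the exponent 1 gives the leading term. *)
rewrite binSn scaler_nat addrK memv_suml // => j _.
by rewrite raddfMn /= lcontr_pure -scaler_nat !memvZ // mem_deg_lt.
Qed.

Lemma dact_deg_lt m h : h \in deg_lt m.+1 -> dact d h \in deg_lt m.
Proof.
apply: deg_lt_ind => -[|i] g im.
  rewrite expr0 mulr1 dact_grouplike; last exact: glgroupP.
  by rewrite d0 scale0r mem0v.
rewrite -[dact _ _](subrK (i.+1%:R *: (glval g * x ^+ i))) memvD //.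
  by apply: subvP (dact_pow g i); apply/deg_ltS/ltnW.
by rewrite memvZ // mem_deg_lt.
Qed.

(** Acting by [d] turns a relation of degree [m + 1] into one of degree [m]
    with leading coefficients [(m + 1) c_g], and [m + 1] is invertible in [k]
    because it is less than [p]. *)
Lemma leading_coef_eq0 m (c : G -> k) : (m < p)%N ->
  \sum_g c g *: (glval g * x ^+ m) \in deg_lt m -> forall g, c g = 0.
Proof.
elim: m c => [|m IHm] c mp.
  rewrite /deg_lt big_ord0 memv0 => /eqP c0.
  apply: glval_independent; rewrite -[RHS]c0.
  by apply: eq_bigr => g _; rewrite expr0 mulr1.
move/dact_deg_lt => Hc g.
have : c g * m.+1%:R = 0.
  apply: (IHm (fun g => c g * m.+1%:R)); first exact: ltnW.
  rewrite -[X in X \in _](subKr (dact d (\sum_g c g *: (glval g * x ^+ m.+1)))).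
  rewrite memvB // linear_sum -sumrB memv_suml // => h _.
  by rewrite linearZ /= -scalerA -scalerBr memvZ // dact_pow.
move/eqP; rewrite mulf_eq0 => /orP[/eqP //|].
by rewrite -(dvdn_pcharf pchark) gtnNdvd.
Qed.

End Derivation.

Lemma pow_independent :
  independent (fun gi : G * 'I_p => glval gi.1 * x ^+ gi.2).
Proof.
move=> c c0.
have [d dE] := derivation_functional.
(* The coefficients, extended by 0 to all natural exponents. *)
pose C (g : G) i := oapp (fun i : 'I_p => c (g, i)) 0 (insub i).
have CE g (i : 'I_p) : C g i = c (g, i) by rewrite /C valK.
have C0 n : (n <= p)%N ->
    \sum_(i < n) \sum_g C g i *: (glval g * x ^+ i) = 0 ->
  forall i g, (i < n)%N -> C g i = 0.
  elim: n => [|n IHn] np //; rewrite big_ord_recr /= => s0.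
  have Cn : forall g, C g n = 0.
    apply: (leading_coef_eq0 (fun g => (dE g).1) (fun g => (dE g).2) np).
    move/eqP: s0; rewrite addrC addr_eq0 => /eqP->.
    rewrite memvN memv_suml // => i _; rewrite memv_suml // => g _.
    by rewrite memvZ // mem_deg_lt.
  move: s0; rewrite [X in _ + X]big1 ?addr0 => [s0 i g|g _]; last first.
    by rewrite Cn scale0r.
  by rewrite ltnS leq_eqVlt => /predU1P[-> //|]; apply: IHn => //; apply: ltnW.
move=> [g i]; rewrite -CE (C0 p) //.
rewrite -[RHS]c0 exchange_big pair_bigA.
by apply: eq_bigr => -[h j] _; rewrite /= CE.
Qed.

Hypothesis genH : generated_by_coradical1 H.

(** The span is stable under left multiplication by [g] and by [x] (commute
    [x] past [g], and reduce [x ^+ p]), hence by [H_1 = sum_g g (k 1 + k x)],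
    which generates [H]. *)
Lemma deg_ltp : deg_lt p = fullv.
Proof.
have mulg (g : G) h : h \in deg_lt p -> glval g * h \in deg_lt p.
  move=> Hh; have := deg_lt_ind (m := p) (f := amull (glval g)) (X := deg_lt p).
  move=> /(_ _ h Hh); rewrite lfunE /=; apply=> i t ip.
  by rewrite lfunE /= mulrA -glvalM mem_deg_lt.
have mulx h : h \in deg_lt p -> x * h \in deg_lt p.
  move=> Hh; have := deg_lt_ind (m := p) (f := amull x) (X := deg_lt p).
  move=> /(_ _ h Hh); rewrite lfunE /=; apply=> i t ip.
  rewrite lfunE /=.
  have := primitive_conj t^-1%g Px; rewrite primE invgK => /vlineP[l lE].
  have -> : x * (glval t * x ^+ i) = l *: (glval t * x ^+ i.+1).
    rewrite exprS mulrA -[x * _]mul1r -(glval_mulV t) -!mulrA.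
    rewrite (mulrA x) (mulrA (glval t^-1%g)) (mulrA _ x) lE.
    by rewrite -scalerAl -scalerAr.
  rewrite memvZ //; move: ip; rewrite leq_eqVlt => /predU1P[->|]; last first.
    exact: mem_deg_lt.
  by rewrite xp -scalerAr memvZ // -[x]expr1 mem_deg_lt.
apply/eqP; rewrite eqEsubv subvf /= -genH; apply: agenv_sub_modl.
  by rewrite -memvE -(glval1 H) -[glval _]mulr1 -(expr0 x) mem_deg_lt // ltnW.
apply/prodvP => h h'; rewrite coradical1E // => /memv_sumP[us usP ->] Hh'.
rewrite mulr_suml memv_suml // => g _.
have /componentP[_ /primitives1P[c [y + ->]] ->] := usP g isT.
rewrite primE => /vlineP[b ->].
rewrite -mulrA mulg // mulrDl -!scalerAl mul1r memvD // memvZ //.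
exact: mulx.
Qed.

Lemma pow_basis :
  basis_of {:H} [seq glval gi.1 * x ^+ gi.2 | gi : G * 'I_p].
Proof.
rewrite /basis_of (iffLR (independentE _) pow_independent) andbT.
rewrite eqEsubv subvf -deg_ltp; apply/subv_sumP => i _; apply/subv_sumP => g _.
by rewrite -memvE memv_span //; apply/imageP; exists (g, i).
Qed.

End PrimitivePowers.

(** * Normalization of the generator and construction of the tuple *)

(** The [m%:R] with [m < p] are already [p] roots of ['X^p - 'X]. *)
Lemma frobenius_fixed (k : fieldType) p (a : k) : p \in [pchar k] ->
  a ^+ p = a -> a != 0 -> exists2 m : nat, (0 < m < p)%N & a = m%:R.
Proof.
move=> pchark ap a0; have p_pr := pcharf_prime pchark.
pose P : {poly k} := 'X^p - 'X.
have sizeP : size P = p.+1.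
  by rewrite size_polyDl ?size_polyXn // size_polyN size_polyX ltnS prime_gt1.
have rootP_nat (m : nat) : root P m%:R.
  by rewrite rootE !hornerE -(pFrobenius_autE pchark) pFrobenius_aut_nat subrr.
pose rs := [seq m%:R : k | m <- iota 0 p].
have uniq_rs : uniq rs.
  rewrite map_inj_in_uniq ?iota_uniq // => m n.
  rewrite !mem_iota /= !add0n => mp np.
  wlog le_mn : m n mp np / (m <= n)%N => [IH|] mn.
    by case/orP: (leq_total m n) => le; [|apply/esym]; apply: IH.
  move/eqP: mn; rewrite eq_sym -subr_eq0 -natrB // -(dvdn_pcharf pchark) => dv.
  apply/eqP; rewrite eqn_leq le_mn -subn_eq0 /=.
  apply: contraTT dv; rewrite -lt0n => nm; rewrite gtnNdvd //.
  exact: leq_ltn_trans (leq_subr _ _) np.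
have : a \in rs.
  apply: contraT => ars; have : (size (a :: rs) < size P)%N.
    apply: max_poly_roots; first by rewrite -size_poly_eq0 sizeP.
      rewrite /= rootE !hornerE ap subrr eqxx /=.
      by apply/allP => _ /mapP[m _ ->].
    by rewrite /= ars.
  by rewrite sizeP /= size_map size_iota ltnn.
case/mapP=> m; rewrite mem_iota /= add0n => mp aE; exists m => //.
by rewrite mp andbT lt0n; apply: contra_neq a0 => m0; rewrite aE m0.
Qed.

(** Scaling by [l] replaces [beta] by [l ^+ (p - 1) beta]. *)
Lemma rescaled_generator (k : closedFieldType) p (A : falgType k) (y : A)
    (beta : k) : (1 < p)%N -> y ^+ p = beta *: y ->
  exists2 l : k, l != 0 & exists alpha : k,
    (alpha = 0 \/ alpha = 1) /\ (l *: y) ^+ p = alpha *: (l *: y).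
Proof.
move=> p1 yp; have [b0|b0] := eqVneq beta 0.
  exists 1; first exact: oner_neq0.
  by exists 0; split; [left | rewrite scale1r yp b0 !scale0r].
have p0 : (0 < p.-1)%N by rewrite -subn1 subn_gt0.
have [l lE] := solve_monicpoly (fun i => if i == 0%N then beta^-1 else 0) p0.
have {}lE : l ^+ p.-1 = beta^-1.
  rewrite lE -(prednK p0) big_ord_recl /= expr0 mulr1 big1 ?addr0 // => i _.
  by rewrite mul0r.
exists l.
  apply: contraNneq b0 => l0; move/eqP: lE.
  by rewrite l0 expr0n -(prednK p0) /= eq_sym invr_eq0.
exists 1; split; [by right|].
rewrite exprZn yp scale1r scalerA; congr (_ *: _).
by rewrite -(prednK (ltnW p1)) exprS lE -mulrA mulVf ?mulr1.
Qed.

Lemma hopf_isomorphic_refl (k : fieldType) (H : hopfType k) :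
  hopf_isomorphic H H.
Proof.
have tmap_id : tmap (@idfun H) (@idfun H) =1 (@idfun (tensor H H)).
  by apply: tensor_ext => u v; rewrite /= tmap_pure.
exists (@idfun H); split; [by exists idfun | | by [] | by []].
by move=> h; rewrite tmap_id.
Qed.

Lemma expr_conj (R : pzRingType) (u v x : R) n :
  v * u = 1 -> u * v = 1 -> (u * x * v) ^+ n = u * x ^+ n * v.
Proof.
move=> vu uv; elim: n => [|n IHn]; first by rewrite !expr0 mulr1.
by rewrite !exprS IHn !mulrA -(mulrA _ v u) vu mulr1.
Qed.

Theorem corollary3p13 (k : closedFieldType) (p : nat) (hp : p \in [pchar k])
    (H : hopfType k) (hpointed : pointed H) (hcocomm : cocommutative H)
    (hrank : has_rank H 1)
    (hgen : generated_by_coradical1 H)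
    (hne : coradical H <> fullv) :
  exists (F : HF_tuple k p) (K : hopfType k) (iota : HF_group F -> K) (x : K),
    [/\ is_HF iota x, hopf_isomorphic H K & conj_eigenvector iota x].
Proof.
have p_gt1 : (1 < p)%N by apply/prime_gt1/(pcharf_prime hp).
have [y y0 primy] := rank1_primitives hcocomm hpointed hgen hne hrank.
have Py : y \in primitives H by rewrite primy memv_line.
have [beta yp] : exists beta, y ^+ p = beta *: y.
  by apply/vlineP; rewrite -primy; apply: primitive_pchar.
have [l l0 [alpha [alpha01 xp]]] := rescaled_generator p_gt1 yp.
pose x := l *: y; have x0 : x != 0 by rewrite scaler_eq0 negb_or l0.
have primx : primitives H = <[x]>%VS.
  apply/eqP; rewrite eq_sym eqEdim primy -memvE memvZ ?memv_line //.
  by rewrite !dim_vline x0 y0.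
have Px : x \in primitives H by rewrite primx memv_line.
have {}xp : x ^+ p = alpha *: x := xp.
have /choice[chi chiE] (g : glgroup H) :
    exists c : k, glval g * x * glval g^-1%g = c *: x.
  by apply/vlineP; rewrite -primx; apply: primitive_conj.
have xI (a b : k) : a *: x = b *: x -> a = b.
  move/eqP; rewrite -subr_eq0 -scalerBl scaler_eq0 (negPf x0) orbF subr_eq0.
  by move/eqP.
have chi1 : chi 1%g = 1.
  by apply: xI; rewrite -chiE invg1 glval1 mul1r mulr1 scale1r.
have chiM g h : chi (g * h)%g = chi g * chi h.
  apply: xI; rewrite -chiE invMg !glvalM.
  transitivity (glval g * (glval h * x * glval h^-1%g) * glval g^-1%g).
    by rewrite !mulrA.
  by rewrite chiE -scalerAr -scalerAl chiE scalerA mulrC.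
have chi0 g : chi g != 0.
  apply: contraTneq (oner_neq0 k) => c0.
  by rewrite -chi1 -(mulgV g) chiM c0 mul0r eqxx.
have chip : alpha = 1 -> forall g, chi g ^+ p = chi g.
  move=> a1 g; have {}xp : x ^+ p = x by rewrite xp a1 scale1r.
  apply: xI; rewrite -{1}xp -exprZn -!chiE.
  rewrite expr_conj ?glval_mulV ?glval_mulVl //.
  by rewrite xp.
have F_c : forall h g : glgroup H, 0 = chi g * 0 + 0.
  by move=> h g; rewrite mulr0 addr0.
have F_case0 : alpha = 0 -> forall g : glgroup H,
    0 *: (kg k (1 ^+ p)%g - kg k (1%g : glgroup H)) = 0.
  by move=> _ g; rewrite scale0r.
have F_a : alpha = 1 -> (1 ^+ p)%g = 1%g :> glgroup H by rewrite expg1n.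
have F_chi : alpha = 1 -> forall g,
    exists2 m : nat, (0 < m < p)%N & chi g = m%:R.
  by move=> a1 g; apply: frobenius_fixed => //; apply: chip.
have F_case1 : alpha = 1 -> forall g : glgroup H,
    (0 * (chi g - 1) + 0 ^+ p - 0) *: (kg k (1%g : glgroup H) - kg k 1%g) = 0.
  by move=> _ g; rewrite subrr scaler0.
(* Cocommutativity makes the skew-primitive generator primitive, hence
   [a = 1]; then [a - 1 = 0], so [c] and [alpha_{-1}] can be taken to be 0. *)
pose F : HF_tuple k p := @HFTuple k p (glgroup H) chi (fun=> 0) 1%g 0 alpha
  (group1 _) chi0 chiM chi1 F_c erefl alpha01 (fun _ => erefl)
  F_case0 F_a F_chi F_case1.
exists F, H, (@glval k H), x; split; first split.
- exact: glval1.
- exact: glvalM.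
- exact: (pow_basis hp hcocomm hpointed x0 primx xp hgen).
- by rewrite /= scale0r add0r.
- by move=> g; rewrite /= scale0r addr0.
- by move=> g i; rewrite /= glval1 comul_powE.
- by move=> g i; apply: counit_pow.
- by move=> g i; rewrite /= invg1 glval1 mulr1 antipode_pow.
- exact: hopf_isomorphic_refl.
by split=> // g; exists (chi g).
Qed.
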